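(* Every arithmetic progression contains infinitely many subsequences of $\ell$ consecutive non-Zeckendorf-Niven terms, where $\ell$ is an arbitrary positive integer. That is, for all positive integers $a,d,\ell$, there are infinitely many integers $k_0\ge 0$ such that none of the $\ell$ consecutive terms $a+k_0d,\ a+(k_0+1)d,\ \dots,\ a+(k_0+\ell-1)d$ of the arithmetic progression $(a+kd)_{k=0}^\infty$ is Zeckendorf-Niven.
   Context: Let $\mathbb{N}$ be the set of positive integers and let $F_i$ be the Fibonacci numbers: $F_0=0$, $F_1=1$, $F_i=F_{i-1}+F_{i-2}$ for $i\ge 2$. By Zeckendorf's theorem, every $n\in\mathbb{N}$ has a unique sequence $(\zeta_i(n))_{i=2}^\infty$ with $\zeta_i(n)\in\{0,1\}$ and $\zeta_i(n)+\zeta_{i+1}(n)\le 1$ for all $i\ge 2$, such that $n=\sum_{i=2}^\infty \zeta_i(n)F_i$ (the Zeckendorf decomposition of $n$). Put $s_Z(n)=\sum_{i=2}^\infty\zeta_i(n)$. A positive integer $n$ is called Zeckendorf-Niven if $s_Z(n)$ divides $n$, and non-Zeckendorf-Niven otherwise. An arithmetic progression is an infinite sequence of positive integers $(a+kd)_{k=0}^\infty$ with $a,d\in\mathbb{N}$. *)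

(* Defs.v *)
From mathcomp Require Import all_boot.
From mathcomp Require Import zify.

Set Implicit Arguments.
Unset Strict Implicit.
Unset Printing Implicit Defensive.

Fixpoint fib (n : nat) : nat :=
  match n with
  | 0 => 0
  | 1 => 1
  | (m.+1 as p).+1 => fib p + fib m
  end.

Arguments fib n : simpl never.

(* Only the digits of index i >= 2 matter; those of index 0 and 1 are
   unconstrained.  The infinite sum is finite: digits vanish from rank N on. *)
Definition is_zeckendorf (n : nat) (z : nat -> bool) : Prop :=
  (forall i, 2 <= i -> z i + z i.+1 <= 1) /\
  (exists N, (forall i, N <= i -> z i = false) /\
             n = \sum_(2 <= i < N) z i * fib i).

Lemma fibSS n : fib n.+2 = fib n.+1 + fib n.
Proof. by []. Qed.

Lemma fib_gt0 n : 0 < fib n.+1.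
Proof. by elim: n => // n IHn; rewrite fibSS; lia. Qed.

Lemma ltn_fibSS n : n < fib n.+2.
Proof.
elim: n => // n IHn; rewrite fibSS; have := fib_gt0 n; lia.
Qed.

Lemma zeckendorf_below k n : n < fib k.+1 ->
  {z : nat -> bool | (forall i, z i + z i.+1 <= 1) /\
    (forall i, k < i -> z i = false) /\ n = \sum_(2 <= i < k.+1) z i * fib i}.
Proof.
have base (m q : nat) : m < 1 -> q < 2 ->
    {z : nat -> bool | (forall i, z i + z i.+1 <= 1) /\
      (forall i, q < i -> z i = false) /\ m = \sum_(2 <= i < q.+1) z i * fib i}.
  move=> m0 q2; exists (fun=> false); split=> //; split=> //.
  by rewrite big_geq //; lia.
pose P k := forall n, n < fib k.+1 ->
  {z : nat -> bool | (forall i, z i + z i.+1 <= 1) /\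
    (forall i, k < i -> z i = false) /\ n = \sum_(2 <= i < k.+1) z i * fib i}.
suff PP : (P k * P k.+1)%type by apply: PP.1.
elim: k {n} => [|k [IH0 IH1]].
  by split=> n n1; apply: base.
split=> // n; rewrite fibSS => ltn.
have [lt|ge] := ltnP n (fib k.+2).
  have [z [zA [z0 zs]]] := IH1 n lt; exists z; split=> //; split.
    by move=> i ki; apply: z0; lia.
  by rewrite big_nat_recr //= z0 // mul0n addn0.
have [|z [zA [z0 zs]]] := IH0 (n - fib k.+2); first lia.
exists (fun i => z i || (i == k.+2)); split; [|split].
- move=> i; have := zA i.
  have [->|ne1] := eqVneq i k.+2; first by rewrite !z0 //; lia.
  have [e|ne2] := eqVneq i.+1 k.+2; last by rewrite !orbF.
  by rewrite e !z0 //; lia.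
- by move=> i ki; rewrite z0; lia.
- rewrite big_nat_recr //= eqxx orbT mul1n.
  have e : \sum_(2 <= i < k.+2) (z i || (i == k.+2)) * fib i
         = \sum_(2 <= i < k.+2) z i * fib i.
    by apply: eq_big_nat => i /andP[_ ik]; rewrite (ltn_eqF ik) orbF.
  rewrite e; suff -> : \sum_(2 <= i < k.+2) z i * fib i = n - fib k.+2 by lia.
  rewrite zs; case: (k) z0 => [|k'] z0; first by rewrite !big_geq.
  by rewrite big_nat_recr //= z0 // mul0n addn0.
Qed.

Lemma zeckendorf_exists n : {z : nat -> bool | is_zeckendorf n z}.
Proof.
have [z [zA [z0 zs]]] := zeckendorf_below (ltn_fibSS n).
by exists z; split=> [i _|] //; exists n.+2; split.
Qed.

Lemma zeckendorf_sum_lt k (z : nat -> bool) :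
  (forall i, 2 <= i -> z i + z i.+1 <= 1) ->
  \sum_(2 <= i < k.+1) z i * fib i < fib k.+1.
Proof.
move=> zA.
suff : (\sum_(2 <= i < k.+1) z i * fib i < fib k.+1) /\
       (\sum_(2 <= i < k.+2) z i * fib i < fib k.+2) by case.
elim: k => [|k [IH0 IH1]]; first by rewrite !big_geq.
split=> //; rewrite big_nat_recr //= (fibSS k.+1).
case zk: (z k.+2); last by rewrite mul0n; lia.
rewrite mul1n addnC ltn_add2l.
case: k IH0 IH1 zk => [|k] IH0 IH1 zk; first by rewrite big_geq.
have := zA k.+2 isT; rewrite zk.
by rewrite big_nat_recr //=; case: (z k.+2) => //; rewrite mul0n addn0.
Qed.

Lemma zeckendorf_unique n z1 z2 :
  is_zeckendorf n z1 -> is_zeckendorf n z2 -> forall i, 2 <= i -> z1 i = z2 i.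
Proof.
move=> [A1 [N1 [Z1 S1]]] [A2 [N2 [Z2 S2]]].
have ext (z : nat -> bool) N M : (forall i, N <= i -> z i = false) -> N <= M ->
    \sum_(2 <= i < M) z i * fib i = \sum_(2 <= i < N) z i * fib i.
  move=> z0 NM; have [N2'|/ltnW N2'] := leqP 2 N.
    rewrite (big_cat_nat N2' NM) /= [X in _ + X]big1_seq ?addn0 // => i.
    by rewrite mem_index_iota => /andP[_ /andP[Ni _]]; rewrite z0.
  rewrite [RHS]big_geq // big1_seq // => i.
  by rewrite mem_index_iota => /andP[_ /andP[i2 _]]; rewrite z0 //; lia.
have key k : \sum_(2 <= i < k.+1) z1 i * fib i = \sum_(2 <= i < k.+1) z2 i * fib i ->
    forall i, 2 <= i < k.+1 -> z1 i = z2 i.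
  elim: k => [|k IHk]; first by move=> _ i; lia.
  case: k IHk => [|k] IHk; first by move=> _ i; lia.
  rewrite !(big_nat_recr k.+2) //= => e.
  have l1 := zeckendorf_sum_lt k.+1 A1; have l2 := zeckendorf_sum_lt k.+1 A2.
  have ek : z1 k.+2 = z2 k.+2.
    by move: e; case: (z1 k.+2); case: (z2 k.+2); rewrite ?mul1n ?mul0n //; lia.
  move=> i /andP[i2]; rewrite ltnS leq_eqVlt => /orP[/eqP -> //|ik].
  by apply: IHk; [move: e; rewrite ek; lia | rewrite i2].
move=> i i2; pose M := (N1 + N2 + i).
apply: (key M); last by rewrite i2 /M; lia.
by rewrite (ext z1 N1) ?(ext z2 N2) -?S1 -?S2 // /M; lia.
Qed.

Definition zeta (n : nat) : nat -> bool := sval (zeckendorf_exists n).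

Lemma zetaP n : is_zeckendorf n (zeta n).
Proof. exact: svalP (zeckendorf_exists n). Qed.

Lemma zeta_eq0 n i : n.+2 <= i -> zeta n i = false.
Proof.
move=> ni; have [z [zA [z0 zs]]] := zeckendorf_below (ltn_fibSS n).
have zP : is_zeckendorf n z by split=> [j _|] //; exists n.+2; split.
by rewrite (zeckendorf_unique (zetaP n) zP) ?z0 //; lia.
Qed.

(* By zeta_eq0 the digits of index at least n + 2 are zero. *)
Definition s_Z (n : nat) : nat := \sum_(2 <= i < n.+2) zeta n i.

Definition zeckendorf_niven (n : nat) : bool := (0 < n) && (s_Z n %| n).

(* Main.v *)
Require Import Defs.
From mathcomp Require Import all_boot ssralg zmodp.
From mathcomp Require Import zify.

(** Let [N = a + l d] and [Q = d (2N)!].  The Fibonacci sequence is purely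
    periodic modulo [Q] and starts at [0], so for some [t] all [fib (t * k)] are
    multiples of [Q], and so is a sum [M] of [N] of them.  If [0 < m < N] and the
    indices are large, the digits of [m] and [M] do not interact, hence
    [s_Z (m + M) = s_Z m + N] lies between [N] and [2N] and divides [M].  If it
    divided [m + M], it would divide [m], which is impossible as [m < N].  Take
    [m = a + j d] and [k0 = M / d]. *)

(** [step] shifts the pair of consecutive Fibonacci residues modulo [Q]. It is injective on a finite
    type, so the orbit of [(0, 1)] returns to its start. *)
Lemma fib_multiple_dvd Q : 0 < Q -> exists2 t, 1 < t & forall k, Q %| fib (t * k).
Proof.
case: Q => // q _.
pose step (p : 'I_q.+1 * 'I_q.+1) := (p.2, (p.1 + p.2)%R).
have step_inj : injective step.
  move=> [x y] [x' y'] /pair_equal_spec[/= -> e]; congr pair.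
  exact: (GRing.addIr y').
pose p0 : 'I_q.+1 * 'I_q.+1 := (inZp 0, inZp 1).
have iterE n : iter n step p0 = (inZp (fib n), inZp (fib n.+1)).
  elim: n => // n IHn; rewrite iterS IHn /step /=; congr pair.
  by apply: val_inj; rewrite /= fibSS modnDm addnC.
have iter_mul k : iter (order step p0 * k) step p0 = p0.
  by elim: k => [|k IHk]; rewrite ?muln0 // mulnS iterD IHk iter_order.
(* Doubling the period ensures [1 < t], since the order is 1 when [Q = 1]. *)
exists (order step p0 * 2) => [|k].
  by have := order_gt0 step p0; lia.
have := iter_mul (2 * k); rewrite mulnA iterE => -[/eqP].
by rewrite mod0n.
Qed.

Lemma leq_fib m n : m <= n -> fib m <= fib n.
Proof.
move=> /subnKC <-; elim: (n - m) => [|i IHi]; first by rewrite addn0.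
apply: leq_trans IHi _; rewrite addnS.
by case: (m + i) => [|r] //; rewrite fibSS leq_addr.
Qed.

Lemma sum_digits_widen (z : nat -> bool) N M :
  (forall i, N <= i -> z i = false) -> N <= M ->
  \sum_(2 <= i < M) z i = \sum_(2 <= i < N) z i.
Proof.
move=> z0 /subnKC <-; elim: (M - N) => [|i IHi]; first by rewrite addn0.
rewrite addnS; have [N2|N2] := leqP 2 (N + i).
  by rewrite big_nat_recr //= IHi z0 ?leq_addr // addn0.
by rewrite !big_geq //; lia.
Qed.

(** By uniqueness, any Zeckendorf digits with any valid cut-off compute [s_Z]; both sums are
    extended to a common range. *)
Lemma s_ZE n (z : nat -> bool) N : is_zeckendorf n z ->
  (forall i, N <= i -> z i = false) -> s_Z n = \sum_(2 <= i < N) z i.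
Proof.
move=> zP z0.
rewrite -(sum_digits_widen _ N (N + n.+2) z0) ?leq_addr // /s_Z.
rewrite -(sum_digits_widen _ n.+2 (N + n.+2) (@zeta_eq0 n)) ?leq_addl //.
apply: eq_big_nat => i /andP[i2 _].
by rewrite (zeckendorf_unique (zetaP n) zP).
Qed.

Lemma s_Z_leq n : s_Z n <= n.
Proof.
rewrite /s_Z.
apply: (@leq_trans (\sum_(2 <= i < n.+2) 1)); last by rewrite sum_nat_const_nat; lia.
by apply: leq_sum => i _; case: (zeta n i).
Qed.

(** The digits of [n] vanish beyond index [k], so digit [k.+2] can be switched on: both its
    neighbours are zero. *)
Lemma s_Z_add_fib n k : n < fib k.+1 -> s_Z (n + fib k.+2) = (s_Z n).+1.
Proof.
move=> ltn; have [z [zA [z0 zs]]] := zeckendorf_below ltn.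
have zP : is_zeckendorf n z by split=> [i _|] //; exists k.+1.
have z0S i : k.+1 < i -> z i = false by move=> ki; apply: z0; lia.
pose z' i := z i || (i == k.+2).
have z'0 i : k.+3 <= i -> z' i = false by rewrite /z' => ki; rewrite z0; lia.
have z'E i : i < k.+2 -> z' i = z i by move=> ik; rewrite /z' (ltn_eqF ik) orbF.
have z'k : z' k.+2 by rewrite /z' eqxx orbT.
have z'P : is_zeckendorf (n + fib k.+2) z'.
  split=> [i _|].
    have := zA i; rewrite /z'.
    have [->|ne1] := eqVneq i k.+2; first by rewrite !z0 //; lia.
    have [e|ne2] := eqVneq i.+1 k.+2; last by rewrite !orbF.
    by rewrite e !z0 //; lia.
  exists k.+3; split=> //; rewrite big_nat_recr //= z'k mul1n; congr (_ + _).
  under eq_big_nat => i /andP[_ ik] do rewrite z'E //.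
  rewrite zs; case: (k) z0 => [|k'] z0; first by rewrite !big_geq.
  by rewrite [RHS]big_nat_recr //= z0 // mul0n addn0.
rewrite (s_ZE _ _ _ z'P z'0) big_nat_recr //= z'k addn1; congr _.+1.
under eq_big_nat => i /andP[_ ik] do rewrite z'E //.
by rewrite (s_ZE n z k.+2 zP).
Qed.

Lemma s_Z_add_sum_fib t b n S : 1 < t -> 1 < b -> n < fib (t * b).-1 ->
  s_Z (n + \sum_(i < S) fib (t * (b + i))) = s_Z n + S.
Proof.
move=> t2 b2 ltn.
(* The size bound is carried through the induction because [s_Z_add_fib] requires it for each new
   summand. *)
suff [] : n + \sum_(i < S) fib (t * (b + i)) < fib (t * (b + S)).-1 /\
          s_Z (n + \sum_(i < S) fib (t * (b + i))) = s_Z n + S by [].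
elim: S => [|S [IHlt IHs]]; first by rewrite big_ord0 !addn0.
rewrite big_ord_recr /= addnA.
have [k kE] : exists k, t * (b + S) = k.+2 by exists (t * (b + S) - 2); nia.
rewrite kE /= in IHlt *; split; last by rewrite s_Z_add_fib // IHs addnS.
(* The new sum is below [fib k.+1 + fib k.+2], and as [1 < t] the next index is at least [k.+4]. *)
apply: (@leq_trans (fib k.+3)); first by rewrite (fibSS k.+1); lia.
by apply: leq_fib; rewrite addnS mulnS kE; lia.
Qed.

Theorem theorem2p7 (a d l : nat) (ha : 0 < a) (hd : 0 < d) (hl : 0 < l) :
  forall K : nat, exists k0 : nat,
    K <= k0 /\
    forall j : nat, j < l -> ~~ zeckendorf_niven (a + (k0 + j) * d).
Proof.
move=> K; pose N := a + l * d.
have N0 : 0 < N by rewrite /N; lia.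
have Q0 : 0 < d * (2 * N)`! by rewrite muln_gt0 hd fact_gt0.
have [t t2 tQ] := fib_multiple_dvd _ Q0.
(* [N] leaves room for the digits of [m], [K * d] makes [M] large enough for [K <= M %/ d], and [3]
   gives [b.-1] the index needed by [ltn_fibSS]. *)
pose b := N + K * d + 3; pose M := \sum_(i < N) fib (t * (b + i)).
have bE : N + K * d < fib (t * b).-1.
  apply: leq_trans (ltn_fibSS _) (leq_fib _ _ _).
  by rewrite /b; nia.
have QM : d * (2 * N)`! %| M by apply: dvdn_sum => i _.
have dM : d %| M by apply: dvdn_trans QM; apply: dvdn_mulr.
exists (M %/ d); split=> [|j jl].
  (* The first summand of [M] alone exceeds [K * d]. *)
  rewrite leq_divRL // /M -(prednK N0) big_ord_recl /= addn0.
  have := leq_fib _ _ (leq_pred (t * b)); lia.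
rewrite mulnDl divnK // addnCA addnC.
set m := a + j * d.
have mN : m < N by rewrite /m /N ltn_add2l ltn_pmul2r.
rewrite /zeckendorf_niven s_Z_add_sum_fib //; [|by rewrite /b; lia|by lia].
have sM : s_Z m + N %| M.
  apply: dvdn_trans QM; apply/dvdn_mull/dvdn_fact.
  by have := s_Z_leq m; lia.
rewrite dvdn_addl // negb_and; apply/orP; right.
by apply/negP => /dvdn_leq; rewrite /m => /(_ _); lia.
Qed.
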